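(* Let $(W,S)$ be an infinite Coxeter system and let $\omega=(\omega_1,\omega_2,\omega_3,\dots)$ be a semi-infinite word in the generators $S$ in which infinitely many group elements occur as subwords. Then the $\omega$-sorting order $(P_\omega,\leq_\omega)$ is an infinite lattice that is supersolvable and join-distributive.
   Context: $\ell$ denotes the length function of $(W,S)$. A (finite) subword $\alpha\subseteq\omega$ is identified with its finite index set $I(\alpha)=\{i_1<\dots<i_k\}\subseteq I(\omega)=\{1,2,3,\dots\}$, with $\alpha=(\omega_{i_1},\dots,\omega_{i_k})$. For a word $\alpha=(\alpha_1,\dots,\alpha_k)$ write $\langle\alpha\rangle=\alpha_1\cdots\alpha_k\in W$; $\alpha$ is reduced if $k=\ell(\langle\alpha\rangle)$. The elements that occur as subwords of $\omega$ are the $\langle\alpha\rangle$ with $\alpha\subseteq\omega$ a finite subword. For finite $A,B\subseteq I(\omega)$, $A\leq_{\mathsf{lex}}B$ means $A=B$ or $\min((A\cup B)\setminus(A\cap B))\in A$. A subword $\alpha\subseteq\omega$ is $\omega$-sorted if it is reduced and $I(\alpha)=\min_{\leq_{\mathsf{lex}}}\{I(\beta):\beta\subseteq\omega\text{ is reduced and }\langle\beta\rangle=\langle\alpha\rangle\}$. $P_\omega$ is the set of $\omega$-sorted words with the order $\alpha\leq_\omega\beta$ iff $I(\alpha)\subseteq I(\beta)$. Let $P$ be a locally finite lattice (all intervals finite). An atomic interval of $P$ is an interval $[x,\bigvee_{y\in Y}y]$ where $Y$ is a set of elements covering $x$ (whose join exists). $P$ is join-distributive if every atomic interval in $P$ is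 boolean, i.e. isomorphic to the lattice of all subsets of a finite set. $P$ is supersolvable if every interval in $P$ is a supersolvable finite lattice, where a finite lattice $L$ is supersolvable if it has a maximal chain $\mathfrak{m}$ such that for every maximal chain $\mathfrak{c}$ of $L$ the sublattice generated by $\mathfrak{m}\cup\mathfrak{c}$ is distributive. *)

(* Defs.v *)
From HB Require Import structures.
From Stdlib Require Import Relation_Operators.
From mathcomp Require Import all_boot all_order finmap.
From mathcomp Require Import boolp classical_sets cardinality.

Set Implicit Arguments.
Unset Strict Implicit.
Unset Printing Implicit Defensive.

Local Open Scope classical_set_scope.

(* Order theory is developed for a subset [L] of a poset [T] with the induced *)
(* order, so that it applies to a whole poset ([L = setT]) and, as a lattice  *)
(* in its own right, to each of its intervals. Joins and meets are relative   *)
(* to [L].                                                                    *)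
Section SubPosets.
Context {d : Order.disp_t} {T : porderType d}.
Implicit Types (L M A Y c m : set T) (x y z : T).

Definition lub_in L A z := (L `&` ubound A) z /\ lbound (L `&` ubound A) z.

Definition glb_in L A z := (L `&` lbound A) z /\ ubound (L `&` lbound A) z.

Definition is_lattice L :=
  forall x y, L x -> L y ->
    (exists z, lub_in L [set x; y] z) /\ (exists z, glb_in L [set x; y] z).

Definition interval_in L x y : set T := [set z | L z /\ (x <= z <= y)%O].

Definition locally_finite L :=
  forall x y, L x -> L y -> finite_set (interval_in L x y).

Definition covers_in L x y :=
  [/\ L x, L y, (x < y)%O & forall z, L z -> ~ ((x < z)%O /\ (z < y)%O)].

(* The condition [x <= z] matters only when [Y] is empty: its join is then    *)
(* the bottom of [L], and [x, z] is an interval only if [x] is that bottom.   *)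
Definition atomic_interval L I :=
  exists x Y z, [/\ L x, (forall y, Y y -> covers_in L x y), lub_in L Y z,
                    (x <= z)%O & I = interval_in L x z].

Definition boolean_lattice L :=
  exists (F : finType) (f : {set F} -> T),
    range f = L /\ forall A B : {set F}, (f A <= f B)%O = (A \subset B).

Definition join_distributive L :=
  [/\ is_lattice L, locally_finite L &
      forall I, atomic_interval L I -> boolean_lattice I].

Definition chain_in L c := c `<=` L /\ total_on c (fun x y => (x <= y)%O).

Definition maximal_chain_in L c :=
  chain_in L c /\ forall c', chain_in L c' -> c `<=` c' -> c' = c.

Definition sublattice_of L M :=
  M `<=` L /\ forall x y z, M x -> M y ->
    (lub_in L [set x; y] z -> M z) /\ (glb_in L [set x; y] z -> M z).

Definition sublattice_generated L A : set T := smallest (sublattice_of L) A.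

(* x /\ (y \/ z) = (x /\ y) \/ (x /\ z), as a relation between the joins and  *)
(* meets involved.                                                            *)
Definition distributive_lattice L :=
  is_lattice L /\
  forall x y z yz xyz xy xz u, L x -> L y -> L z ->
    lub_in L [set y; z] yz -> glb_in L [set x; yz] xyz ->
    glb_in L [set x; y] xy -> glb_in L [set x; z] xz ->
    lub_in L [set xy; xz] u -> xyz = u.

Definition supersolvable_finite L :=
  [/\ finite_set L, is_lattice L &
      exists m, maximal_chain_in L m /\
        forall c, maximal_chain_in L c ->
          distributive_lattice (sublattice_generated L (m `|` c))].

Definition supersolvable L :=
  [/\ is_lattice L, locally_finite L &
      forall x y, L x -> L y -> (x <= y)%O ->
        supersolvable_finite (interval_in L x y)].

End SubPosets.

Section CoxeterSystems.
Variables (W : groupType) (S : set W).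

Definition word_in (u : seq W) := forall s, s \in u -> S s.

Definition word_prod (u : seq W) : W := (\prod_(s <- u) s)%g.

(* The value 0 stands for infinity. The second condition says that m(s,s) = 1 *)
(* and that m(s,t) >= 2 (possibly infinite) for s <> t.                       *)
Definition coxeter_matrix (m : W -> W -> nat) :=
  forall s t, S s -> S t -> m s t = m t s /\ (m s t = 1%N <-> s = t).

(* Insertion of the relator (s t)^m(s,t) at any place in a word; for          *)
(* m(s,t) = 0 (infinity) the relator is the empty word.                       *)
Inductive coxeter_insertion (m : W -> W -> nat) : seq W -> seq W -> Prop :=
| CoxeterInsertion u v s t of S s & S t :
    coxeter_insertion m
      (u ++ v) (u ++ flatten (nseq (m s t) [:: s; t]) ++ v).

(* W has the presentation < S | (s t)^m(s,t) = 1, s, t in S >: it is the      *)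
(* quotient of the free monoid on S by the congruence generated by the        *)
(* relators. Inverses of generators are not needed as letters, since the      *)
(* relators with s = t are the words s s.                                     *)
Definition coxeter_presentation (m : W -> W -> nat) :=
  (forall w, exists2 u, word_in u & word_prod u = w) /\
  forall u v, word_in u -> word_in v ->
    (word_prod u = word_prod v <->
     clos_refl_sym_trans (seq W) (coxeter_insertion m) u v).

Definition coxeter_system :=
  exists m, coxeter_matrix m /\ coxeter_presentation m.

Definition cox_length (w : W) : nat :=
  xget 0%N [set k | (exists u, [/\ word_in u, word_prod u = w & size u = k]) /\
                    forall u, word_in u -> word_prod u = w -> (k <= size u)%N].

End CoxeterSystems.

Section SortingOrder.
Local Open Scope fset_scope.
Variables (W : groupType) (S : set W).

(* Words are indexed from 0 instead of 1; a finite subword of [omega] is      *)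
(* given by its index set.                                                    *)
Variable omega : nat -> W.
Implicit Types A B : {fset nat}.

Definition subword A : seq W := [seq omega i | i <- sort leq A].

Definition subword_prod A : W := word_prod (subword A).

Definition reduced_subword A := #|` A| = cox_length S (subword_prod A).

Definition lex_le A B :=
  A = B \/
  exists2 i, i \in A & i \in (A `|` B) `\` (A `&` B) /\
    forall j, j \in (A `|` B) `\` (A `&` B) -> (i <= j)%N.

Definition omega_sorted A :=
  reduced_subword A /\
  forall B, reduced_subword B -> subword_prod B = subword_prod A -> lex_le A B.

Definition sorting_poset : Type := {A : {fset nat} | `[< omega_sorted A >]}.

HB.instance Definition _ := Choice.on sorting_poset.

Definition sorting_le (a b : sorting_poset) : bool := val a `<=` val b.

Lemma sorting_le_refl : reflexive sorting_le.
Proof. by move=> a; apply: fsubset_refl. Qed.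

Lemma sorting_le_anti : antisymmetric sorting_le.
Proof. by move=> a b; rewrite /sorting_le -eqEfsubset => /eqP/val_inj. Qed.

Lemma sorting_le_trans : transitive sorting_le.
Proof. by move=> b a c; apply: fsubset_trans. Qed.

Fact sorting_display : Order.disp_t. Proof. exact: Order.Disp tt tt. Qed.

HB.instance Definition _ :=
  Order.Le_isPOrder.Build sorting_display sorting_poset
    sorting_le_refl sorting_le_anti sorting_le_trans.

Lemma sorting_leE (a b : sorting_poset) : (a <= b)%O = (val a `<=` val b).
Proof. by []. Qed.

End SortingOrder.

(* Main.v *)
(* The parity of the number of times a reflection occurs in a word depends    *)
(* only on the element spelled, since the Coxeter relators contain every      *)
(* reflection an even number of times. This gives the strong exchange         *)
(* condition, hence the insertion lemma: if [uv], [us] and [sv] are reduced   *)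
(* then so is [usv]. An index set [A] is sorted iff, for every [i], the       *)
(* letter [omega i] followed by the letters of [A] after [i] is reduced. With *)
(* the insertion lemma, this shows that if [A], [B] are sorted and [x] is the *)
(* least element of [B] outside [A], then [A] with [x] added is sorted.       *)
(* The rest is a property of set families: sorted sets are closed under       *)
(* union, covers add one element, atomic intervals contain all intermediate   *)
(* sets, and in [X, Z] the sets [X] + [Z] below [n] form a maximal chain      *)
(* whose members meet every element in the intersection; so this chain and    *)
(* any other one lie in a sublattice where joins are unions and meets are     *)
(* intersections.                                                             *)
Require Import Defs.
From Stdlib Require Import Relation_Operators.
From mathcomp Require Import all_boot all_order finmap.
From mathcomp Require Import boolp classical_sets cardinality.

Local Open Scope classical_set_scope.

(** The sorted index sets form an antimatroid: the empty set is sorted ([sorted0]), and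
    [sorted_step] adds to one sorted set the least element of another that it lacks. Two lemmas
    carry this. [reduced_word_insert] comes from the reflection cocycle [refl_parity], an invariant
    of the group element whose odd values allow a letter to be deleted. [sorted_greedy] turns
    lexicographic minimality into a condition on each tail of the index set. Hence joins are unions,
    and a meet is the largest sorted subset of the intersection. A cover adds one element, and each
    new element of the top of an atomic interval can be added alone to the bottom, so the interval
    is a power set. Between [x] and [z], adding the elements of [z] in increasing order gives a
    maximal chain. Its intersections with sets of the interval are truncations, again sorted, so the
    unions of its intersections with a second chain are closed under intersection
    ([chain_unions_meet]), whence distributivity. *)

Section ReducedWords.
Set Implicit Arguments.
Unset Strict Implicit.
Local Open Scope group_scope.
Variables (W : groupType) (S : set W).
Hypothesis coxeterWS : coxeter_system S.
Implicit Types (s t x y : W) (u v : seq W).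

(** * Words, Coxeter relators and reflection parity *)

Lemma word_prod_nil : word_prod [::] = 1 :> W.
Proof. by rewrite /word_prod big_nil. Qed.

Lemma word_prod_cons s u : word_prod (s :: u) = s * word_prod u.
Proof. by rewrite /word_prod big_cons. Qed.

Lemma word_prod_cat u v : word_prod (u ++ v) = word_prod u * word_prod v.
Proof. by rewrite /word_prod big_cat. Qed.

Lemma word_in_cons s u : S s -> word_in S u -> word_in S (s :: u).
Proof. by move=> Ss Su t; rewrite inE => /predU1P[->|/Su]. Qed.

Lemma word_in_cat u v : word_in S (u ++ v) <-> word_in S u /\ word_in S v.
Proof.
split=> [Suv|[Su Sv] s]; last by rewrite mem_cat => /orP[/Su|/Sv].
by split=> s us; apply: Suv; rewrite mem_cat us ?orbT.
Qed.

Lemma word_in_braid m s t : S s -> S t ->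
  word_in S (flatten (nseq m [:: s; t])).
Proof.
move=> Ss St; elim: m => [|m IHm] //=.
by do 2!apply: word_in_cons => //.
Qed.

Lemma word_prod_braid m s t :
  word_prod (flatten (nseq m [:: s; t])) = (s * t) ^+ m.
Proof.
elim: m => [|m IHm]; first by rewrite word_prod_nil.
by rewrite /= !word_prod_cons IHm expgS mulgA.
Qed.

Lemma coxeter_relator : exists m,
  [/\ coxeter_presentation S m, forall s, S s -> m s s = 1%N &
      forall s t, S s -> S t -> (s * t) ^+ m s t = 1].
Proof.
have [m [mP pres]] := coxeterWS; exists m; split=> // [s Ss|s t Ss St].
  by have [_ ->] := mP s s Ss Ss.
rewrite -word_prod_braid -word_prod_nil; apply/esym/pres.2 => //.
  exact: word_in_braid.
apply: rst_step; have := @CoxeterInsertion W S m [::] [::] s t Ss St.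
by rewrite /= cats0.
Qed.

Lemma mulss s : S s -> s * s = 1.
Proof. by case: coxeter_relator => m [_ m1 mr] Ss;
  rewrite -(mr s s) ?m1 ?expg1. Qed.

(* For a reflection [x] and a word [u = s_1 ... s_k], the parity of the       *)
(* number of [i] such that [x = s_1 ... s_(i-1) s_i s_(i-1) ... s_1].         *)
Fixpoint refl_parity u x : bool :=
  if u is s :: u' then (x == s) (+) refl_parity u' (x ^ s) else false.

Lemma refl_parity_cat u v x :
  refl_parity (u ++ v) x = refl_parity u x (+) refl_parity v (x ^ word_prod u).
Proof.
elim: u x => [|s u IHu] x; first by rewrite word_prod_nil conjg1.
by rewrite /= IHu word_prod_cons conjgM addbA.
Qed.

(** The reflections attached to the successive letters are [s], [sts], [ststs], and so on;
    conjugating by [s * t] shifts the exponent by two. *)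
Lemma refl_parity_braid m s t x : S s -> S t ->
  refl_parity (flatten (nseq m [:: s; t])) x =
    \big[addb/false]_(0 <= j < m.*2) (x == (s * t) ^+ j * s).
Proof.
move=> Ss St; elim: m x => [|m IHm] x; first by rewrite big_geq.
rewrite doubleS !big_nat_recl //= IHm -conjgM expg0 mul1g expg1.
congr (_ (+) (_ (+) _)).
  rewrite -[in RHS](inj_eq (@conjg_inj _ s)); congr (_ == _).
  by rewrite conjgE -!mulgA (mulss Ss) mulg1 mulKg.
apply: eq_bigr => j _; rewrite -[in RHS](inj_eq (@conjg_inj _ (s * t))).
congr (_ == _); rewrite conjgE expgS expgSr -!mulgA.
rewrite [s * (s * t)]mulgA mulss // mul1g mulss // mulg1.
by rewrite [s * (t * _)]mulgA mulKg.
Qed.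

(** The terms [j] and [m + j] of the sum over [2m] letters coincide and cancel. *)
Lemma refl_parity_relator m s t x : S s -> S t -> (s * t) ^+ m = 1 ->
  refl_parity (flatten (nseq m [:: s; t])) x = false.
Proof.
move=> Ss St stm; rewrite refl_parity_braid // -addnn.
rewrite (big_cat_nat _ (leq_addr m m)) //= -{2}[m]add0n big_addn addnK.
under [X in _ (+) X]eq_bigr => j _ do rewrite expgnDr stm mulg1.
exact: addbb.
Qed.

(** An inserted relator contributes even parity and has product 1, so it does not alter the
    conjugation applied to the letters after it. *)
Lemma refl_parity_word_prod u v x : word_in S u -> word_in S v ->
  word_prod u = word_prod v -> refl_parity u x = refl_parity v x.
Proof.
have [m [pres _ mr]] := coxeter_relator => Su Sv /(pres.2 u v Su Sv) uv.
elim: {u v Su Sv}uv x => // [_ _ [u v s t Ss St]|u v w _ IHuv _ IHvw] x.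
- rewrite !refl_parity_cat refl_parity_relator ?mr //.
  by rewrite word_prod_braid mr // conjg1.
- by rewrite IHuv.
Qed.

(** An odd reflection occurs at least once, and multiplying by it erases the corresponding letter.
    The word is an image under [f] so that the erased letter is known by its position. *)
Lemma refl_parity_deletion (I : Type) (f : I -> W) l x :
    word_in S (map f l) -> refl_parity (map f l) x ->
  exists l1 i l2, l = l1 ++ i :: l2 /\
    word_prod (map f (l1 ++ l2)) = x * word_prod (map f l).
Proof.
elim: l x => //= i l IHl x Sl.
have Si : S (f i) by apply: Sl; rewrite mem_head.
have Sl' : word_in S (map f l) by move=> s sl; apply: Sl; rewrite inE sl orbT.
have [-> _|xi /= /(IHl _ Sl')[l1 [j [l2 [-> lE]]]]] := eqVneq x (f i).
  by exists [::], i, l; rewrite word_prod_cons mulgA mulss // mul1g.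
exists (i :: l1), j, l2; split=> //=.
by rewrite !word_prod_cons lE (mulgA x) (conjgC x) -(mulgA (f i)).
Qed.

(** * Reduced words, exchange and insertion *)

Definition reduced_word u :=
  word_in S u /\
  forall v, word_in S v -> word_prod v = word_prod u -> size u <= size v.

Lemma reduced_word_cox_length u : word_in S u ->
  reduced_word u <-> size u = cox_length S (word_prod u).
Proof.
move=> Su; rewrite /cox_length; case: xgetP => [k _ [[v [Sv vu kE]] kmin]|none].
  split=> [[_ umin]|uk]; last by split=> // w Sw wu; rewrite uk; apply: kmin.
  by apply/anti_leq; rewrite kmin // -kE umin.
(* The default case of [xget] is impossible: [u] itself is a spelling, so a least length exists. *)
pose P k := `[< exists v, [/\ word_in S v, word_prod v = word_prod u & size v =
  k] >].
have exP : exists k, P k by exists (size u); apply/asboolP; exists u.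
case: (ex_minnP exP) => k /asboolP kP kmin; case: (none k); split=> // v Sv vu.
by apply: kmin; apply/asboolP; exists v.
Qed.

Lemma reduced_word_nil : reduced_word [::].
Proof. by []. Qed.

Lemma reduced_word_eq u v : reduced_word u -> reduced_word v ->
  word_prod u = word_prod v -> size u = size v.
Proof.
by move=> [Su umin] [Sv vmin] uv; apply/anti_leq; rewrite umin // vmin.
Qed.

Lemma reduced_word_catl u v : reduced_word (u ++ v) -> reduced_word u.
Proof.
move=> [/word_in_cat[Su Sv] umin]; split=> // w Sw wu.
have := umin (w ++ v); rewrite !word_prod_cat wu !size_cat leq_add2r;
  apply=> //.
exact/word_in_cat.
Qed.

Lemma reduced_word_catr u v : reduced_word (u ++ v) -> reduced_word v.
Proof.
move=> [/word_in_cat[Su Sv] vmin]; split=> // w Sw wv.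
have := vmin (u ++ w); rewrite !word_prod_cat wv !size_cat leq_add2l;
  apply=> //.
exact/word_in_cat.
Qed.

Lemma refl_parity_shorten u x : word_in S u -> refl_parity u x ->
  exists v, [/\ word_in S v, word_prod v = x * word_prod u &
    size u = (size v).+1].
Proof.
move=> Su; rewrite -{1}[u]map_id => /refl_parity_deletion; rewrite map_id.
move=> /(_ Su)[u1 [s [u2 [uE]]]]; rewrite !map_id => vE; exists (u1 ++ u2).
rewrite {2}uE !size_cat /= addnS; split=> // t; rewrite mem_cat => tu.
by apply: Su; rewrite uE mem_cat inE orbCA tu orbT.
Qed.

(** If [s] is odd in [u], deletion spells [s * u] with fewer letters than [u]. If it is even, it is
    odd in every spelling of [s * u], and deletion leaves a spelling of [u]. *)
Lemma refl_parity_reduced_cons s u : S s -> reduced_word u ->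
  reduced_word (s :: u) <-> refl_parity u s = false.
Proof.
move=> Ss [Su umin]; split.
  move=> [Ssu sumin]; apply/negP=> /(refl_parity_shorten Su)[v [Sv vE uv]].
  by have := sumin v Sv; rewrite vE word_prod_cons => /(_ erefl);
    rewrite /= uv ltnNge leqnSn.
move=> us; split=> [|v Sv vE]; first exact: word_in_cons.
have : refl_parity v s.
  rewrite (@refl_parity_word_prod _ (s :: u)) //=; last exact: word_in_cons.
  by rewrite eqxx conjgE mulKg us.
move=> /(refl_parity_shorten Sv)[v' [Sv' v'E ->]]; apply: umin => //.
by rewrite v'E vE word_prod_cons mulgA mulss // mul1g.
Qed.

(** The reflection [t = u s u^-1] is even in [u] and [s] is even in [v], so [t] is odd in every
    spelling of [usv]; deleting a letter from one leaves a spelling of [uv]. *)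
Lemma reduced_word_insert u s v :
    reduced_word (u ++ v) -> reduced_word (rcons u s) -> reduced_word (s :: v)
      ->
  reduced_word (u ++ s :: v).
Proof.
move=> uv us sv; have [[/word_in_cat[Su Sv] uvmin] [Sus usmin]] := (uv, us).
have Ss : S s by apply: Sus; rewrite mem_rcons mem_head.
pose t := s ^ (word_prod u)^-1;
  have tuE : t ^ word_prod u = s by rewrite conjgKV.
have tE : t * word_prod u = word_prod u * s by rewrite (conjgC t) tuE.
have ut : refl_parity u t = false.
  apply/negP=> /(refl_parity_shorten Su)[w [Sw wE uw]].
  have := usmin w Sw; rewrite -cats1 wE tE word_prod_cat word_prod_cons
    word_prod_nil mulg1.
  by move=> /(_ erefl); rewrite size_cat uw addn1 ltnNge leqnSn.
have vs : refl_parity v s = false.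
  by apply/refl_parity_reduced_cons => //; apply: reduced_word_catr uv.
split=> [|w Sw wE]; first by apply/word_in_cat; split=> //; apply: word_in_cons.
have Susv : word_in S (u ++ s :: v).
  by apply/word_in_cat; split=> //; apply: word_in_cons.
have : refl_parity w t.
  rewrite (@refl_parity_word_prod _ (u ++ s :: v)) // refl_parity_cat ut tuE /=.
  by rewrite eqxx conjgE mulKg vs.
move=> /(refl_parity_shorten Sw)[w' [Sw' w'E ->]].
rewrite size_cat /= addnS ltnS -size_cat; apply: uvmin => //.
rewrite w'E wE !word_prod_cat word_prod_cons !mulgA tE -(mulgA _ s s) mulss //.
by rewrite mulg1.
Qed.
End ReducedWords.

Section SortedWords.
Local Open Scope fset_scope.
Set Implicit Arguments.
Unset Strict Implicit.
Variables (W : groupType) (S : set W) (omega : nat -> W).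
Hypothesis coxeterWS : coxeter_system S.
Hypothesis omegaS : forall i, S (omega i).
Implicit Types (A B : {fset nat}) (i j k m n : nat).

(** * Subwords restricted to an interval of positions *)

Definition subword_in A m n : seq W :=
  [seq omega i | i <- index_iota m n & i \in A].

Lemma word_in_subword_in A m n : word_in S (subword_in A m n).
Proof. by move=> s /mapP[i _ ->]. Qed.

Lemma subword_in_geq A m n : n <= m -> subword_in A m n = [::].
Proof. by move=> nm; rewrite /subword_in /index_iota (eqP nm). Qed.

Lemma subword_in_cat A m n p : m <= n -> n <= p ->
  subword_in A m p = subword_in A m n ++ subword_in A n p.
Proof.
move=> mn np; rewrite -map_cat -filter_cat /index_iota -{2}(subnKC mn) -iotaD.
by rewrite addnC addnBA // subnK.
Qed.

Lemma subword_in_mem A m n : m < n -> m \in A ->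
  subword_in A m n = omega m :: subword_in A m.+1 n.
Proof.
by move=> mn mA; rewrite /subword_in /index_iota -(subnSK mn) /= mA.
Qed.

Lemma subword_in_notin A m n : m \notin A ->
  subword_in A m n = subword_in A m.+1 n.
Proof.
have [nm _|mn mA] := leqP n m; first by rewrite !subword_in_geq // ltnW.
by rewrite /subword_in /index_iota -(subnSK mn) /= (negPf mA).
Qed.

Lemma subword_in_rcons A m n : m <= n -> n \in A ->
  subword_in A m n.+1 = rcons (subword_in A m n) (omega n).
Proof.
move=> mn nA; rewrite (subword_in_cat _ mn (leqnSn n)) (subword_in_mem (ltnSn
  n)) //.
by rewrite (subword_in_geq _ (leqnn n.+1)) cats1.
Qed.

Lemma eq_subword_in A B m n :
    (forall i, m <= i -> i < n -> (i \in A) = (i \in B)) ->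
  subword_in A m n = subword_in B m n.
Proof.
move=> AB; congr map; apply: eq_in_filter => i.
by rewrite mem_index_iota => /andP[mi ni]; apply: AB.
Qed.

Lemma subword_in_bound A m n p : (forall i, i \in A -> i < n) -> n <= p ->
  subword_in A m p = subword_in A m n.
Proof.
move=> An np; have [mn|/ltnW nm] := leqP m n.
  rewrite (subword_in_cat _ mn np) (_ : subword_in A n p = [::]) ?cats0 //.
  rewrite /subword_in (eq_in_filter (a2 := pred0)) ?filter_pred0 // => i.
  rewrite mem_index_iota => /andP[ni _]; apply/negP => /An.
  by rewrite ltnNge ni.
have -> : subword_in A m n = [::] by rewrite subword_in_geq.
rewrite /subword_in (eq_in_filter (a2 := pred0)) ?filter_pred0 // => i.
rewrite mem_index_iota => /andP[mi _]; apply/negP => /An.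
by rewrite ltnNge (leq_trans nm mi).
Qed.

Lemma fset_nat_bound A : exists n, forall i, i \in A -> i < n.
Proof.
exists (\max_(i <- A) i).+1 => i iA; rewrite ltnS.
exact: (leq_bigmax_seq (F := id)).
Qed.

Lemma subwordE A n : (forall i, i \in A -> i < n) ->
  subword omega A = subword_in A 0 n.
Proof.
move=> An; congr map; apply: (irr_sorted_eq ltn_trans ltnn).
- rewrite ltn_sorted_uniq_leq sort_uniq fset_uniq.
  exact: (sort_sorted leq_total).
- exact/sorted_filter/iota_ltn_sorted/ltn_trans.
move=> i; rewrite mem_sort mem_filter mem_index_iota /=.
by case iA : (i \in A); rewrite // An.
Qed.

(** * Greedy index sets and sorted words *)

Lemma reduced_subwordE A :
  reduced_subword S omega A <-> reduced_word S (subword omega A).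
Proof.
rewrite reduced_word_cox_length //; last by move=> s /mapP[i _ ->].
by rewrite /reduced_subword size_map size_sort.
Qed.

(* For [i] in [A] the condition says that [A] is reduced from [i] on; for the *)
(* other [i] it says that the greedy choice of letters of [omega] that spells *)
(* the element of [A] skips [i].                                              *)
Definition greedy_from m A :=
  forall i n, m <= i -> reduced_word S (omega i :: subword_in A i.+1 n).

Definition greedy A := greedy_from 0 A.

Lemma greedy_from_reduced m A n :
  greedy_from m A -> reduced_word S (subword_in A m n).
Proof.
move=> Am; suff: forall d, m <= n - d -> reduced_word S (subword_in A (n - d)
  n).
  have [nm _|/ltnW mn] := leqP n m; last by move/(_ (n - m));
    rewrite subKn //; apply.
  by rewrite subword_in_geq //; apply: reduced_word_nil.
elim=> [|d IHd] md; first by rewrite subword_in_geq ?subn0 //;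
  apply: reduced_word_nil.
have md' : m <= n - d by rewrite (leq_trans md) // leq_sub2l.
have [nd|dn] := leqP n d.
  by rewrite (eqP (leqW nd)); move: (IHd md'); rewrite (eqP nd).
have ndE : n - d = (n - d.+1).+1 by rewrite subnSK.
have [ndA|ndA] := boolP (n - d.+1 \in A);
  last by rewrite subword_in_notin // -ndE; apply: IHd.
by rewrite subword_in_mem // ?ltn_subrL ?(leq_trans _ dn) //; apply: Am.
Qed.

Lemma greedy_from_bounded m A p : (forall i, i \in A -> i < p) ->
    (forall i, m <= i -> reduced_word S (omega i :: subword_in A i.+1 p)) ->
  greedy_from m A.
Proof.
move=> Ap red i n /red; have [np|/ltnW pn] := leqP n p; last first.
  by rewrite (subword_in_bound _ Ap pn).
have [ni|/ltnW ltin] := leqP n i.+1.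
  by move=> iP; rewrite subword_in_geq //;
    apply: (reduced_word_catl (u := [:: _])) iP.
by rewrite (subword_in_cat _ ltin np) -cat_cons => /reduced_word_catl.
Qed.

Lemma subword_in_deletion A m n x : refl_parity (subword_in A m n) x ->
  exists j, word_prod (subword_in (A `\ j) m n) =
    (x * word_prod (subword_in A m n))%g.
Proof.
move=> /(refl_parity_deletion coxeterWS (@word_in_subword_in A m n)).
move=> [l1 [j [l2 [lE <-]]]]; exists j; congr (word_prod (map _ _)).
have : uniq (l1 ++ j :: l2) by rewrite -lE filter_uniq // iota_uniq.
rewrite cat_uniq /= negb_or -!andbA => /and5P[_ jl1 _ jl2 _].
transitivity [seq i <- l1 ++ j :: l2 | i != j].
  by rewrite -lE -filter_predI; apply: eq_filter => i /=; rewrite !inE.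
rewrite filter_cat /= eqxx; congr (_ ++ _); apply/all_filterP/allP=> i il.
  by apply: contraNneq jl1 => <-.
by apply: contraNneq jl2 => <-.
Qed.

(** The set is built from right to left: position [m] is taken exactly when [omega m] is a left
    descent of the element to be spelled. *)
Lemma exists_greedy_from d p A : d <= p ->
  exists2 B, (forall i, i \in B -> i < p) /\ greedy_from (p - d) B &
    word_prod (subword_in B (p - d) p) = word_prod (subword_in A (p - d) p).
Proof.
elim: d A => [|d IHd] A dp.
  exists fset0; last by rewrite subn0 !subword_in_geq.
  split=> // i n _; rewrite (@subword_in_bound _ _ 0) // subword_in_geq //.
  by apply/refl_parity_reduced_cons => //; apply: reduced_word_nil.
set m := p - d.+1; set s := omega m.
have mE : p - d = m.+1 by rewrite /m subnSK.
have ltmp : m < p by rewrite /m ltn_subrL (leq_trans _ dp).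
have {IHd}IHd := IHd _ (ltnW dp); rewrite mE in IHd.
have Ss : S s := omegaS m.
have ss : (s * s = 1)%g := mulss coxeterWS Ss.
(* One of [w] and [s * w] does not have [s] as a left descent; [B] spells it. *)
have [b [B [Bp Bm BE Bs]]] : exists b B,
    [/\ forall i, i \in B -> i < p, greedy_from m.+1 B,
        word_prod (subword_in B m.+1 p) =
          (s ^+ nat_of_bool b * word_prod (subword_in A m.+1 p))%g &
        refl_parity (subword_in B m.+1 p) s = false].
  have [B [Bp Bm] BE] := IHd A.
  case Bs : (refl_parity (subword_in B m.+1 p) s); last first.
    by exists false, B; rewrite expg0 mul1g.
  have [j jE] := subword_in_deletion Bs; have [C [Cp Cm CE]] := IHd (B `\ j).
  exists true, C; rewrite expg1 CE jE BE; split=> //.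
  have : refl_parity (s :: subword_in C m.+1 p) s = refl_parity (subword_in B
    m.+1 p) s.
    apply: (refl_parity_word_prod coxeterWS).
    - by apply: word_in_cons => //; apply: word_in_subword_in.
    - exact: word_in_subword_in.
    - by rewrite word_prod_cons CE jE mulgA ss mul1g.
  by rewrite /= eqxx Bs conjgE mulKg; case: refl_parity.
(* The target is [s] to the power [m \in A] times the tail of [A], and [B] spells [s ^+ b] times
   that tail, so [m] is needed exactly when the two exponents differ. *)
pose C := if b == (m \in A) then B `\ m else m |` B.
have CB n i : m <= i -> subword_in C i.+1 n = subword_in B i.+1 n.
  move=> mi; apply: eq_subword_in => j /(leq_ltn_trans mi) mj _; rewrite /C.
  by case: ifP => _; rewrite !inE gtn_eqF.
have Cp i : i \in C -> i < p.
  by rewrite /C; case: ifP => _; rewrite !inE;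
    [move=> /andP[_] | move=> /predU1P[->//|]]; apply: Bp.
exists C; first split=> //.
  apply: (@greedy_from_bounded _ _ p) => // i; rewrite leq_eqVlt.
  case/predU1P=> [<-|mi]; rewrite CB ?(ltnW mi) //; last exact: Bm.
  by apply/refl_parity_reduced_cons => //; apply: greedy_from_reduced.
have CE : word_prod (subword_in C m p) =
    (s ^+ nat_of_bool (m \in C) * word_prod (subword_in B m.+1 p))%g.
  have [mC|mC] := boolP (m \in C);
    last by rewrite subword_in_notin // CB ?expg0 ?mul1g.
  by rewrite subword_in_mem // word_prod_cons CB.
have AE : word_prod (subword_in A m p) =
    (s ^+ nat_of_bool (m \in A) * word_prod (subword_in A m.+1 p))%g.
  have [mA|mA] := boolP (m \in A);
    last by rewrite subword_in_notin // expg0 mul1g.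
  by rewrite subword_in_mem // word_prod_cons.
rewrite CE AE BE mulgA; congr (_ * _)%g; rewrite /C.
by case: (b) (m \in A) => [] [];
  rewrite /= !inE eqxx ?expg0 ?expg1 ?mul1g ?mulg1.
Qed.

Lemma subword_prodE A n : (forall i, i \in A -> i < n) ->
  subword_prod omega A = word_prod (subword_in A 0 n).
Proof. by move=> An; rewrite /subword_prod (subwordE An). Qed.

Lemma greedy_reduced A : greedy A -> reduced_subword S omega A.
Proof.
move=> gA; have [n An] := fset_nat_bound A.
by apply/reduced_subwordE; rewrite (subwordE An); apply: greedy_from_reduced.
Qed.

Lemma exists_greedy A : exists2 B, greedy B &
  subword_prod omega B = subword_prod omega A.
Proof.
have [n An] := fset_nat_bound A.
have [B [Bn gB] BE] := exists_greedy_from A (leqnn n).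
by rewrite subnn in gB BE; exists B;
  rewrite // (subword_prodE Bn) (subword_prodE An).
Qed.

Lemma lex_le_anti A B : lex_le A B -> lex_le B A -> A = B.
Proof.
case=> [//|[i iA [iAB imin]]] [//|[j jB [jAB jmin]]].
rewrite fsetUC fsetIC in jAB jmin.
have ij : i = j by apply/anti_leq; rewrite imin // jmin.
by move: iAB; rewrite !inE iA ij jB.
Qed.

(** At the first difference [i], suppose [B] has [i] and [A] does not. The tails from [i] spell the
    same element, so the tail of [A] is one letter longer than that of [B] after [i]. Prefixing
    [omega i] to the tail of [A] spells the latter by a word that is reduced by greediness, yet
    longer. *)
Lemma greedy_sorted A : greedy A -> omega_sorted S omega A.
Proof.
move=> gA; split=> [|B /reduced_subwordE rB BA]; first exact: greedy_reduced.
have [AB|AB] := eqVneq A B; [by left | right].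
have exi : exists i, i \in (A `|` B) `\` (A `&` B).
  apply/fset0Pn; apply: contraNneq AB => /fsetP AB; apply/eqP/fsetP=> i.
  by have := AB i; rewrite !inE; case: (i \in A); case: (i \in B).
case: (ex_minnP exi) => i iAB imin; exists i => //.
have ltAB j : j < i -> (j \in A) = (j \in B).
  move=> ji; have := contra (imin j); rewrite -ltnNge => /(_ ji).
  by rewrite !inE; case: (j \in A); case: (j \in B).
apply: contraT => iA; have iB : i \in B by move: iAB;
  rewrite !inE (negPf iA) => /andP[].
have [p pP] := fset_nat_bound (A `|` B).
have Ap j : j \in A -> j < p by move=> jA; apply: pP; rewrite inE jA.
have Bp j : j \in B -> j < p by move=> jB; apply: pP; rewrite inE jB orbT.
have ip := ltnW (Bp i iB).
have eqi : subword_in B 0 i = subword_in A 0 i.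
  by apply: eq_subword_in => j _ /ltAB.
have : word_prod (subword_in B i p) = word_prod (subword_in A i p).
  move: BA; rewrite (subword_prodE Ap) (subword_prodE Bp).
  rewrite !(subword_in_cat _ (leq0n i) ip) eqi !word_prod_cat; exact: mulgI.
rewrite subword_in_mem ?Bp // (subword_in_notin _ iA) => BAi.
have riB : reduced_word S (omega i :: subword_in B i.+1 p).
  move: rB; rewrite (subwordE Bp) (subword_in_cat _ (leq0n i) ip)
    (subword_in_mem (Bp i iB) iB).
  exact: reduced_word_catr.
have riA := gA i p (leq0n i).
have rA := reduced_word_catr (u := [:: _]) riA.
have := reduced_word_eq riB rA BAi; rewrite /= => sB.
have rB' := reduced_word_catr (u := [:: _]) riB.
have := reduced_word_eq riA rB'.
rewrite word_prod_cons -BAi word_prod_cons mulgA (mulss coxeterWS (omegaS i))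
  mul1g => /(_ erefl) /=.
by rewrite -sB => /eqP; rewrite -[X in _ == X]add0n -addn2 addnC eqn_add2r.
Qed.

Lemma sorted_greedy A : omega_sorted S omega A <-> greedy A.
Proof.
split=> [sA|]; last exact: greedy_sorted.
have [B gB BA] := exists_greedy A; have sB := greedy_sorted gB.
rewrite (_ : A = B) //; apply: lex_le_anti; first exact: sA.2 sB.1 BA.
exact: sB.2 sA.1 (esym BA).
Qed.

(** For [i < k], the insertion lemma applies with [u] formed of [omega i] and the letters of [A]
    between [i] and [k], and [v] the letters of [A] after [k]. *)
Lemma greedy_insert A k : greedy A ->
    (forall i, i < k ->
       reduced_word S (omega i :: rcons (subword_in A i.+1 k) (omega k))) ->
  greedy (k |` A).
Proof.
move=> gA red i n _; have [kA|kA] := boolP (k \in A).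
  by rewrite mem_fset1U //; apply: gA.
have [ki|ik] := leqP k i.
  rewrite (@eq_subword_in _ A); first exact: gA.
  by move=> j ij _; rewrite !inE gtn_eqF ?(leq_ltn_trans ki).
have [nk|kn] := leqP n k.
  rewrite (@eq_subword_in _ A); first exact: gA.
  by move=> j _ jn; rewrite !inE ltn_eqF ?(leq_trans jn).
rewrite (subword_in_cat _ ik (ltnW kn)) (@subword_in_mem _ k) ?fset1U1 //.
rewrite (@eq_subword_in _ A i.+1); last by move=> j _ jk; rewrite !inE ltn_eqF.
rewrite (@eq_subword_in _ A k.+1); last by move=> j kj _; rewrite !inE gtn_eqF.
rewrite -cat_cons; apply: reduced_word_insert => //; last exact: gA.
- by rewrite cat_cons -(subword_in_notin _ kA) -subword_in_cat ?(ltnW kn) //;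
  apply: gA.
- by rewrite rcons_cons; apply: red.
Qed.

(* With [x] the least element of [B] outside [A], the elements of [A] below   *)
(* [x] are inserted into [B] one at a time, in increasing order; the result   *)
(* shows that [omega x] may follow any final segment of [A] below [x].        *)
Lemma sorted_step A B x :
    omega_sorted S omega A -> omega_sorted S omega B -> x \in B ->
    (forall y, y \in B -> y < x -> y \in A) ->
  omega_sorted S omega (x |` A).
Proof.
rewrite !sorted_greedy => gA gB xB BA; apply: greedy_insert => // i ix.
pose C k := [fset j in A | j < k] `|` B.
have CA k j : k <= x -> j < k -> (j \in C k) = (j \in A).
  move=> kx jk; rewrite !inE jk andbT; case jA: (j \in A) => //=.
  by apply/negP=> /BA; rewrite jA => /(_ (leq_trans jk kx)).
have gC k : k <= x -> greedy (C k).
  elim: k => [|k IHk] kx.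
    rewrite (_ : C 0 = B) //; apply/fsetP=> j; rewrite !inE.
    by rewrite ltn0 andbF.
  have [kA|kA] := boolP (k \in A).
    rewrite (_ : C k.+1 = k |` C k).
      (* Below [k] the set [C k] agrees with [A], so the condition for inserting [k] is the
         greediness of [A], cut just after [k]. *)
      apply: greedy_insert => [|j jk]; first exact: IHk (ltnW kx).
      rewrite (@eq_subword_in _ A); last by move=> l _; apply: CA (ltnW kx).
      by rewrite -subword_in_rcons //; apply: gA.
    apply/fsetP=> j; rewrite !inE ltnS leq_eqVlt.
    by have [->|] := eqVneq j k; rewrite ?kA.
  rewrite (_ : C k.+1 = C k); first exact: IHk (ltnW kx).
  apply/fsetP=> j; rewrite !inE ltnS leq_eqVlt.
  by have [->|] := eqVneq j k; rewrite ?(negPf kA).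
(* [C x] agrees with [A] below [x] and contains [x]; its greediness, cut just after [x], is what
   inserting [x] into [A] requires. *)
have := gC x (leqnn x) i x.+1 (leq0n i); rewrite subword_in_rcons //.
  by rewrite (@eq_subword_in _ A) // => j _; apply: CA.
by rewrite !inE xB orbT.
Qed.
End SortedWords.

Section SortingLattice.
Local Open Scope fset_scope.
Import Order.POrderTheory.
Set Implicit Arguments.
Unset Strict Implicit.
Variables (W : groupType) (S : set W) (omega : nat -> W).
Hypothesis coxeterWS : coxeter_system S.
Hypothesis omegaS : forall i, S (omega i).
Local Notation sorted := (omega_sorted S omega).
Local Notation P := (sorting_poset S omega).
Implicit Types (A B : {fset nat}) (x y z a b : P) (L M : set P).

(** * Sorted sets as an antimatroid; joins and meets *)

Lemma sorted0 : sorted fset0.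
Proof.
have [B gB BE] := exists_greedy coxeterWS omegaS fset0.
rewrite (_ : fset0 = B); first exact: greedy_sorted.
have [sB rB] := (greedy_sorted coxeterWS omegaS gB, greedy_reduced omegaS gB).
apply/esym/cardfs0_eq; rewrite rB BE.
have r0 : reduced_subword S omega fset0.
  by apply/(reduced_subwordE omegaS); rewrite /subword (_ : sort _ _ = [::]).
by rewrite -r0 cardfs0.
Qed.

Lemma exists_sorted_step A B : sorted A -> sorted B -> ~~ (B `<=` A) ->
  exists i, [/\ i \in B, i \notin A & sorted (i |` A)].
Proof.
move=> sA sB BA; have exi : exists i, (i \in B) && (i \notin A).
  by case/fsubsetPn: BA => i iB iA; exists i; rewrite iB.
case: (ex_minnP exi) => i /andP[iB iA] imin; exists i; split=> //.
apply: (sorted_step coxeterWS omegaS sA sB iB) => j jB; apply: contraTT => jA.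
by rewrite -leqNgt imin // jB.
Qed.

(** The elements of [B] enter in increasing order, so [sorted_step] applies each time. The
    intermediate stages later form the maximal chain. *)
Lemma sortedU_trunc A B n : sorted A -> sorted B ->
  sorted (A `|` [fset i in B | i < n]).
Proof.
move=> sA sB; elim: n => [|n IHn].
  rewrite (_ : _ `|` _ = A) //; apply/fsetP=> i.
  by rewrite !inE ltn0 andbF orbF.
have [/andP[nB nA]|nBA] := boolP ((n \in B) && (n \notin A)).
  rewrite (_ : _ `|` _ = n |` (A `|` [fset i in B | i < n])).
    apply: (sorted_step coxeterWS omegaS IHn sB nB) => i iB ltin.
    by rewrite !inE iB ltin orbT.
  apply/fsetP=> i; rewrite !inE ltnS leq_eqVlt.
  by have [->|] := eqVneq i n; rewrite ?nB ?orbT.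
rewrite (_ : _ `|` _ = A `|` [fset i in B | i < n]) //.
apply/fsetP=> i; rewrite !inE ltnS leq_eqVlt.
by have [->|//] := eqVneq i n; move: nBA; case: (n \in A); case: (n \in B).
Qed.

Lemma sortedU A B : sorted A -> sorted B -> sorted (A `|` B).
Proof.
move=> sA sB; have [n Bn] := fset_nat_bound B.
rewrite (_ : B = [fset i in B | i < n]); first exact: sortedU_trunc.
by apply/fsetP=> i; rewrite !inE; case iB: (i \in B); rewrite // Bn.
Qed.

Lemma sorted_cover A :
    (forall i, i \in A -> exists B, [/\ sorted B, i \in B & B `<=` A]) ->
  sorted A.
Proof.
move=> cA; have [n An] := fset_nat_bound A.
suff /(_ n)[B [sB BA AB]] : forall m, exists B,
    [/\ sorted B, B `<=` A & forall i, i \in A -> i < m -> i \in B].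
  rewrite (_ : A = B) //; apply/eqP; rewrite eqEfsubset BA andbT.
  by apply/fsubsetP=> i iA; apply: AB (An i iA).
elim=> [|m [B [sB BA AB]]]; first by exists fset0; split=> //; apply: sorted0.
have [mA|mA] := boolP (m \in A); last first.
  exists B; split=> // i iA; rewrite ltnS leq_eqVlt => /predU1P[im|];
    last exact: AB.
  by rewrite im (negPf mA) in iA.
have [C [sC mC CA]] := cA m mA; exists (B `|` C); split.
- exact: sortedU.
- by rewrite fsubUset BA.
- move=> i iA; rewrite ltnS leq_eqVlt inE => /predU1P[->|/(AB i iA)->//].
  by rewrite mC orbT.
Qed.

(** The union of all sorted subsets of [A], hence the largest one: the interior operator of the
    antimatroid. *)
Definition sorted_core A : {fset nat} :=
  [fset i in A | `[< exists B, [/\ sorted B, i \in B & B `<=` A] >]].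

Lemma sorted_core_sub A : sorted_core A `<=` A.
Proof. by apply/fsubsetP=> i; rewrite !inE => /andP[]. Qed.

Lemma sub_sorted_core A B : sorted B -> B `<=` A -> B `<=` sorted_core A.
Proof.
move=> sB BA; apply/fsubsetP=> i iB; rewrite !inE (fsubsetP BA) //=.
by apply/asboolP; exists B.
Qed.

Lemma sorted_sorted_core A : sorted (sorted_core A).
Proof.
apply: sorted_cover => i; rewrite !inE => /andP[iA /asboolP[B [sB iB BA]]].
by exists B; split=> //; apply: sub_sorted_core.
Qed.

Lemma sorted_val x : sorted (val x).
Proof. exact/asboolP/(valP x). Qed.

Definition sorting_elt A (sA : sorted A) : P := exist _ A (asboolT sA).

Definition sorting_join x y : P :=
  sorting_elt (sortedU (sorted_val x) (sorted_val y)).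

Definition sorting_meet x y : P :=
  sorting_elt (sorted_sorted_core (val x `&` val y)).

Lemma sorting_joinP x y z : (sorting_join x y <= z)%O = (x <= z)%O && (y <=
  z)%O.
Proof. by rewrite !sorting_leE fsubUset. Qed.

Lemma sorting_meetP x y z : (z <= sorting_meet x y)%O = (z <= x)%O && (z <=
  y)%O.
Proof.
rewrite !sorting_leE -fsubsetI; apply/idP/idP => [zxy|].
  exact: fsubset_trans zxy (sorted_core_sub _).
exact: sub_sorted_core (sorted_val z).
Qed.

Lemma lub_in_join L x y z : L (sorting_join x y) ->
  lub_in L [set x; y] z <-> z = sorting_join x y.
Proof.
move=> Lxy; have /andP[xj yj] : (x <= sorting_join x y)%O && (y <= sorting_join
  x y)%O.
  by rewrite -sorting_joinP lexx.
have ubj : ubound [set x; y] (sorting_join x y) by move=> t [->|->].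
split=> [[[Lz xyz] zmin]|->].
  apply/le_anti; rewrite zmin // sorting_joinP.
  by rewrite !xyz //; [right|left].
split=> // t [_ xyt]; rewrite sorting_joinP.
by rewrite !xyt //; [right|left].
Qed.

Lemma glb_in_meet L x y z : L (sorting_meet x y) ->
  glb_in L [set x; y] z <-> z = sorting_meet x y.
Proof.
move=> Lxy; have /andP[xj yj] : (sorting_meet x y <= x)%O && (sorting_meet x y
  <= y)%O.
  by rewrite -sorting_meetP lexx.
have lbm : lbound [set x; y] (sorting_meet x y) by move=> t [->|->].
split=> [[[Lz xyz] zmax]|->].
  apply/le_anti; rewrite zmax // sorting_meetP.
  by rewrite !xyz //; [right|left].
split=> // t [_ xyt]; rewrite sorting_meetP.
by rewrite !xyt //; [right|left].
Qed.

Lemma is_lattice_closed L :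
    (forall x y, L x -> L y -> L (sorting_join x y) /\ L (sorting_meet x y)) ->
  is_lattice L.
Proof.
move=> cL x y Lx Ly; have [Lj Lm] := cL x y Lx Ly; split.
  by exists (sorting_join x y); apply/lub_in_join.
by exists (sorting_meet x y); apply/glb_in_meet.
Qed.

Lemma sorting_is_lattice : is_lattice [set: P].
Proof. exact: is_lattice_closed. Qed.

Lemma interval_closed x z a b :
    interval_in setT x z a -> interval_in setT x z b ->
  interval_in setT x z (sorting_join a b) /\ interval_in setT x z (sorting_meet
    a b).
Proof.
move=> [_ /andP[xa az]] [_ /andP[xb bz]]; split; split=> //.
  rewrite sorting_joinP az bz !andbT; apply: le_trans xa _.
  by have := sorting_joinP a b (sorting_join a b); rewrite lexx => /esym/andP[].
rewrite sorting_meetP xa xb; apply: le_trans az.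
by have := sorting_meetP a b (sorting_meet a b); rewrite lexx => /esym/andP[].
Qed.

Lemma sorting_locally_finite : locally_finite [set: P].
Proof.
(* Subsets of [z] that are not sorted are sent to the default [x]. *)
move=> x z _ _; pose g A : P := insubd x A.
apply: (@sub_finite_set _ _ (g @` [set` fpowerset (val z)])).
  move=> y [_ /andP[_ yz]]; exists (val y); last exact: valKd.
  by rewrite /= fpowersetE.
exact/finite_image/finite_fset.
Qed.

Lemma sorting_infinite :
    infinite_set [set w | exists A : {fset nat}, subword_prod omega A = w] ->
  infinite_set [set: P].
Proof.
apply: contra_not => finP.
apply: (@sub_finite_set _ _ ((fun x => subword_prod omega (val x)) @` [set:
  P])).
  move=> w [A <-]; have [B gB BA] := exists_greedy coxeterWS omegaS A.
  by exists (sorting_elt (greedy_sorted coxeterWS omegaS gB)).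
exact: finite_image.
Qed.

(** * Covers and atomic intervals *)

Lemma covers_fset1U x y : covers_in setT x y -> exists i, val y = i |` val x.
Proof.
case=> _ _ xy nomid; have := xy; rewrite lt_leAnge !sorting_leE.
move=> /andP[sxy nyx].
have [i [iy ix sxi]] := exists_sorted_step (sorted_val x) (sorted_val y) nyx.
exists i; apply/esym/eqP; rewrite eqEfsubset fsubUset fsub1set iy sxy /=.
apply/negPn/negP => nle; apply: (nomid (sorting_elt sxi)) => //.
split; rewrite lt_leAnge !sorting_leE /=.
  by rewrite fsubsetU1 fsubUset fsub1set (negPf ix).
by rewrite fsubUset fsub1set iy sxy.
Qed.

(** The elements of [z] that can be added alone to [x] form a sorted set containing every member of
    [Y], so it contains the join [z]. *)
Lemma atomic_interval_step x (Y : set P) z i :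
    (forall y, Y y -> covers_in setT x y) -> lub_in setT Y z -> (x <= z)%O ->
    i \in val z -> sorted (i |` val x).
Proof.
move=> Yx [[_ Yz] zmin] xz iz.
pose U := [fset j in val z | `[< sorted (j |` val x) >]].
have sx := sorted_val x.
have sU : sorted U.
  apply: sorted_cover => j; rewrite !inE => /andP[jz /asboolP sj].
  exists (j |` val x); split=> //; first exact: fset1U1.
  apply/fsubsetP=> k; rewrite !inE => /predU1P[->|kx]; first by rewrite jz;
    apply/asboolP.
  by rewrite (fsubsetP xz) //=; apply/asboolP; rewrite mem_fset1U.
have /fsubsetP/(_ i iz) : (z <= sorting_elt sU)%O.
  apply: zmin; split=> // y Yy; have [j yE] := covers_fset1U (Yx y Yy).
  apply/fsubsetP=> k ky; rewrite !inE (fsubsetP (Yz y Yy)) //=; apply/asboolP.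
  move: ky; rewrite yE !inE => /predU1P[->|kx]; last by rewrite mem_fset1U.
  by rewrite -yE; apply: sorted_val.
by rewrite !inE iz => /asboolP.
Qed.

(** Any set between [x] and [z] is a union of [x] with one-element sorted extensions of it, hence is
    sorted. *)
Lemma atomic_interval_boolean I :
  atomic_interval [set: P] I -> boolean_lattice I.
Proof.
case=> x [Y [z [_ Yx Yz xz ->]]].
have step i := @atomic_interval_step x Y z i Yx Yz xz.
pose F := val z `\` val x;
  pose E (A : {set F}) := val x `|` [fset val e | e in A].
have memE (A : {set F}) (e : F) : (val e \in E A) = (e \in A).
  rewrite inE mem_imfset; last exact: val_inj.
  by have := valP e; rewrite inE => /andP[/negPf->].
have Ez (A : {set F}) : E A `<=` val z.
  rewrite fsubUset (xz : val x `<=` val z) /=;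
    apply/fsubsetP=> i /imfsetP[e _ ->].
  by have := valP e; rewrite inE => /andP[].
have sE (A : {set F}) : sorted (E A).
  apply: sorted_cover => i; rewrite inE => /orP[ix|/imfsetP[e /= eA ->]].
    by exists (val x); split; [exact: sorted_val | | exact: fsubsetUl].
  exists (val e |` val x); split; last 2 first.
  - exact: fset1U1.
  - by rewrite fsubUset fsub1set memE eA fsubsetUl.
  by apply: step; have := valP e; rewrite inE => /andP[].
exists F, (fun A : {set F} => sorting_elt (sE A)); split.
  apply/seteqP; split=> [_ [A _ <-]|y [_ /andP[xy yz]]].
    by split=> //; apply/andP; split; [exact: fsubsetUl | exact: Ez].
  exists [set e : F | val e \in val y]%SET => //; apply: val_inj.
  apply/fsetP=> i; rewrite /= inE; have [ix|ix] /= := boolP (i \in val x).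
    by rewrite (fsubsetP xy).
  apply/imfsetP/idP => [[e /= ey ->]|iy]; first by rewrite inE in ey.
  have iF : i \in F by rewrite inE ix (fsubsetP yz).
  by exists [` iF] => //=; rewrite inE.
move=> A B; rewrite sorting_leE; apply/idP/fintype.subsetP => [AB e|AB].
  by rewrite -!memE; apply: (fsubsetP AB).
rewrite fsubUset fsubsetUl; apply/fsubsetP=> _ /imfsetP[e /= eA ->].
by rewrite memE AB.
Qed.

(** * The distinguished maximal chain of an interval *)

Section MaximalChain.
Variables x z : P.
Hypothesis xz : (x <= z)%O.
Local Notation I := (interval_in [set: P] x z).

Definition trunc n : P :=
  sorting_elt (sortedU_trunc n (sorted_val x) (sorted_val z)).

Lemma mem_trunc n i :
  (i \in val (trunc n)) = (i \in val x) || (i \in val z) && (i < n).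
Proof. by rewrite !inE. Qed.

Lemma trunc_mono m n : m <= n -> (trunc m <= trunc n)%O.
Proof.
move=> mn; apply/fsubsetP=> i; rewrite !mem_trunc.
by case: (i \in val x) => //= /andP[-> im]; apply: leq_trans im mn.
Qed.

Lemma trunc_interval n : I (trunc n).
Proof.
split=> //; apply/andP; split; first exact: fsubsetUl.
rewrite sorting_leE fsubUset (xz : val x `<=` val z); apply/fsubsetP=> i.
by rewrite !inE => /andP[].
Qed.

Lemma trunc_top : exists n, trunc n = z.
Proof.
have [n zn] := fset_nat_bound (val z); exists n.
apply: val_inj; apply/fsetP=> i; rewrite mem_trunc.
have [ix|_] /= := boolP (i \in val x); first by rewrite (fsubsetP xz).
by case iz: (i \in val z); rewrite // zn.
Qed.

(** An element [y] comparable with the whole chain and not above [z] lies between two consecutive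
    truncations, which differ by at most one element; the larger one is not below [y], so [y] is the
    smaller. *)
Lemma trunc_maximal_chain : maximal_chain_in I (range trunc).
Proof.
split; first split=> [_ [n _ <-]|_ _ [m _ <-] [n _ <-]];
  first exact: trunc_interval.
  by have [/trunc_mono|/ltnW/trunc_mono] := leqP m n; [left | right].
move=> c [cI cc] mc; apply/seteqP; split=> // y cy.
have [_ /andP[xy yz]] := cI y cy.
have [zy|nzy] := boolP (z <= y)%O.
  have [n nz] := trunc_top; exists n => //; rewrite nz.
  by apply/le_anti; rewrite zy.
have exn : exists n, ~~ (trunc n <= y)%O by have [n nz] := trunc_top;
  exists n; rewrite nz.
case: (ex_minnP exn) => -[|n] ny nmin.
  case/negP: ny; apply/fsubsetP=> i; rewrite mem_trunc ltn0 andbF orbF.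
  exact: (fsubsetP xy).
have nlt : (trunc n <= y)%O by apply: contraT => /nmin; rewrite ltnn.
exists n => //; apply/le_anti; rewrite nlt /=.
have ytn : (y <= trunc n.+1)%O.
  by have [|tny|//] := cc (trunc n.+1) y _ cy; [apply: mc;
    exists n.+1 | rewrite tny in ny].
have nNy : n \notin val y.
  apply: contra ny => ny; apply/fsubsetP=> i; rewrite mem_trunc ltnS leq_eqVlt.
  case/orP=> [ix|/andP[iz /predU1P[->//|ltin]]]; first exact: (fsubsetP xy).
  by apply: (fsubsetP nlt); rewrite mem_trunc iz ltin orbT.
apply/fsubsetP=> i iy; have := fsubsetP ytn i iy;
  rewrite !mem_trunc ltnS leq_eqVlt.
by have [in_|//] := eqVneq i n; rewrite -in_ iy in nNy.
Qed.

Variable c : set P.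
Hypothesis cmax : maximal_chain_in I c.

Lemma maximal_chain_top : c z.
Proof.
have [[cI cc] cM] := cmax.
rewrite -(cM (c `|` [set z])%classic); [by right| |by move=> y; left].
split=> [y [/cI//|->]|y y' [cy|->] [cy'|->]].
- by split=> //; rewrite xz lexx.
- exact: cc.
- by left; have [_ /andP[]] := cI y cy.
- by right; have [_ /andP[]] := cI y' cy'.
- by left.
Qed.

(* The lattice of sets generated by the two chains. *)
Definition chain_unions : set P := [set y | I y /\
  forall i, i \in val y -> exists n C,
    [/\ c C, i \in val (trunc n) `&` val C & val (trunc n) `&` val C `<=` val
      y]].

(** The intersection is [x] together with the part of [C] below [n], a truncation of [C]. *)
Lemma sorted_trunc_inter n C : c C -> sorted (val (trunc n) `&` val C).
Proof.
move=> cC; have [_ /andP[xC Cz]] := cmax.1.1 _ cC.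
rewrite (_ : _ `&` _ = val x `|` [fset i in val C | i < n]).
  by apply: sortedU_trunc; apply: sorted_val.
apply/fsetP=> i; rewrite 2!inE mem_trunc !inE.
have [/(fsubsetP xC)->//|_] := boolP (i \in val x).
have [/(fsubsetP Cz)->|] := boolP (i \in val C); by rewrite ?andbT ?andbF.
Qed.

(** Two sets [trunc m] with [C] and [trunc n] with [C'] intersect in a set of the same form, with
    the smaller index and the smaller of [C], [C']. So the intersection of [a] and [b] is covered by
    sorted sets and is itself the meet. *)
Lemma chain_unions_meet a b : chain_unions a -> chain_unions b ->
  val (sorting_meet a b) = val a `&` val b /\ chain_unions (sorting_meet a b).
Proof.
move=> [Ia ca] [Ib cb]; pose D := val a `&` val b.
have cD i : i \in D -> exists n C,
    [/\ c C, i \in val (trunc n) `&` val C & val (trunc n) `&` val C `<=` D].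
  rewrite inE => /andP[/ca[m [C [cC iC Ca]]] /cb[n [C' [cC' iC' Cb]]]].
  have [C'' cC'' CE] : exists2 C'' : P, c C'' & val C'' = val C `&` val C'.
    have [CC'|CC'] := cmax.1.2 _ _ cC cC'; [exists C | exists C'] => //.
      exact/esym/fsetIidPl.
    exact/esym/fsetIidPr.
  have tE j : (j \in val (trunc (minn m n)) `&` val C'') =
      (j \in val (trunc m) `&` val C) && (j \in val (trunc n) `&` val C').
    rewrite CE !in_fsetI !mem_trunc leq_min.
    by case: (j \in val x); case: (j \in val z); case: (j \in val C);
       case: (j \in val C'); rewrite /= ?andbT ?andbF.
  exists (minn m n), C''; split=> //; first by rewrite tE iC.
  apply/fsubsetP=> j; rewrite tE => /andP[/(fsubsetP Ca) ja /(fsubsetP Cb) jb].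
  by rewrite inE ja.
have sD : sorted D.
  apply: sorted_cover => i /cD[n [C [cC iC CD]]].
  by exists (val (trunc n) `&` val C); split=> //; apply: sorted_trunc_inter.
have mE : val (sorting_meet a b) = D.
  by apply/eqP; rewrite eqEfsubset sorted_core_sub sub_sorted_core.
split=> //; split; first by have [] := interval_closed Ia Ib.
by rewrite mE.
Qed.

Lemma chain_unions_join a b : chain_unions a -> chain_unions b ->
  chain_unions (sorting_join a b).
Proof.
move=> [Ia ca] [Ib cb]; split=> [|i]; first by have [] := interval_closed Ia Ib.
rewrite /= inE => /orP[/ca|/cb] [n [C [cC iC Csub]]]; exists n, C; split=> //.
  exact: fsubset_trans Csub (fsubsetUl _ _).
exact: fsubset_trans Csub (fsubsetUr _ _).
Qed.

Lemma chain_unions_sublattice : sublattice_of I chain_unions.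
Proof.
split=> [y []//|a b y ca cb].
have [Ij Im] := interval_closed ca.1 cb.1; split.
  by move=> /(lub_in_join _ Ij)->; apply: chain_unions_join.
by move=> /(glb_in_meet _ Im)->; have [] := chain_unions_meet ca cb.
Qed.

Lemma chains_sub_chain_unions : ((range trunc `|` c) `<=` chain_unions)%classic.
Proof.
move=> y [[n _ <-]|cy].
  split=> [|i it]; first exact: trunc_interval.
  exists n, z; split; first exact: maximal_chain_top.
    rewrite inE it; have [_ /andP[_ /fsubsetP]] := trunc_interval n.
    exact.
  exact: fsubsetIl.
split=> [|i iy]; first exact: cmax.1.1.
have [n nz] := trunc_top; have [_ /andP[_ yz]] := cmax.1.1 _ cy.
exists n, y; split=> //; last exact: fsubsetIr.
by rewrite nz inE iy (fsubsetP yz).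
Qed.

(** The generated sublattice lies in [chain_unions], where join and meet are union and intersection,
    so the distributive law of sets applies. *)
Lemma chains_distributive :
  distributive_lattice (sublattice_generated I (range trunc `|` c)%classic).
Proof.
set G := sublattice_generated _ _.
have GM : (G `<=` chain_unions)%classic.
  apply: smallest_sub; [exact: chain_unions_sublattice | exact:
    chains_sub_chain_unions].
have Gcl a b : G a -> G b -> G (sorting_join a b) /\ G (sorting_meet a b).
  move=> Ga Gb; have [Ij Im] := interval_closed (GM _ Ga).1 (GM _ Gb).1.
  split=> M MP; have [[_ Mcl] _] := MP.
    by apply: (Mcl a b _ (Ga M MP) (Gb M MP)).1; apply/lub_in_join.
  by apply: (Mcl a b _ (Ga M MP) (Gb M MP)).2; apply/glb_in_meet.
have Gmeet a b : G a -> G b -> val (sorting_meet a b) = val a `&` val b.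
  by move=> /GM ca /GM cb; have [] := chain_unions_meet ca cb.
split; first exact: is_lattice_closed.
move=> u v w vw uvw uv uw t Gu Gv Gw.
have [[Gvw _] [[Guv1 Guv] [Guw1 Guw]]] := (Gcl v w Gv Gw, (Gcl u v Gu Gv, Gcl u
  w Gu Gw)).
move=> /(lub_in_join _ Gvw)-> {vw}.
have [_ Guvw] := Gcl _ _ Gu Gvw.
move=> /(glb_in_meet _ Guvw)-> {uvw}.
move=> /(glb_in_meet _ Guv)-> {uv} /(glb_in_meet _ Guw)-> {uw}.
have [Gt _] := Gcl _ _ Guv Guw.
move=> /(lub_in_join _ Gt)->; apply: val_inj.
rewrite Gmeet // -[RHS]/(val (sorting_meet u v) `|` val (sorting_meet u w)).
by rewrite !Gmeet // -fsetIUr.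
Qed.
End MaximalChain.

Lemma sorting_supersolvable : supersolvable [set: P].
Proof.
split; [exact: sorting_is_lattice | exact: sorting_locally_finite |].
move=> x z _ _ xz; split.
- exact: sorting_locally_finite.
- by apply: is_lattice_closed => a b; apply: interval_closed.
exists (range (trunc x z)); split; first exact: trunc_maximal_chain.
by move=> c cmax; apply: chains_distributive.
Qed.

End SortingLattice.

Theorem theorem5p2 (W : groupType) (S : set W) (omega : nat -> W)
    (coxeterWS : coxeter_system S)
    (infiniteW : infinite_set [set: W])
    (omegaS : forall i, S (omega i))
    (infinite_subwords :
      infinite_set [set w | exists A : {fset nat}, subword_prod omega A = w]) :
  [/\ infinite_set [set: sorting_poset S omega],
      is_lattice [set: sorting_poset S omega],
      supersolvable [set: sorting_poset S omega] &
      join_distributive [set: sorting_poset S omega]].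
Proof.
split.
- exact: sorting_infinite.
- exact: sorting_is_lattice.
- exact: sorting_supersolvable.
- split.
  + exact: sorting_is_lattice.
  + exact: sorting_locally_finite.
  + by move=> I; apply: atomic_interval_boolean.
Qed.
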